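(* Fix the number of models $n$, and let the number of queries $m=m(r)$ satisfy $m\to\infty$ as the number of replicates $r\to\infty$. Assume that for some $q\in\mathbb{N}$ there exist vectors $\boldsymbol{\phi}_1,\dots,\boldsymbol{\phi}_n\in\mathbb{R}^q$ (not depending on $m$ or $r$) such that for every pair $(i,i')\in[n]^2$, $\boldsymbol{\Delta}_{ii'}=\frac{1}{m}\lVert\boldsymbol{\mu}_i-\boldsymbol{\mu}_{i'}\rVert_F\to\lVert\boldsymbol{\phi}_i-\boldsymbol{\phi}_{i'}\rVert$ as $r,m\to\infty$, and let $\boldsymbol{\Delta}^{(\infty)}=\left(\lVert\boldsymbol{\phi}_i-\boldsymbol{\phi}_{i'}\rVert\right)_{i,i'=1}^n\in\mathbb{R}^{n\times n}$. Let $\boldsymbol{\Sigma}_{ij}$ be the covariance matrix of the distribution $F_{ij}$ and $\gamma_{ij}=\mathrm{trace}(\boldsymbol{\Sigma}_{ij})$. If, for all $i\in[n]$, $$\lim_{r\to\infty}\frac{\frac{1}{m}\sum_{j=1}^{m}\gamma_{ij}}{r}=0,$$ then $\lVert\mathbf{D}-\boldsymbol{\Delta}^{(\infty)}\rVert_F\to 0$ in probability as $r\to\infty$.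
   Context: Write $[n]=\{1,\dots,n\}$; $\lVert\cdot\rVert$ is the Euclidean norm and $\lVert\cdot\rVert_F$ the Frobenius norm. There are $n$ generative models $f_1,\dots,f_n$ (random maps from a query space $\mathcal{Q}$ to an output space $\mathcal{X}$) and queries $q_1,q_2,\dots\in\mathcal{Q}$, of which the first $m$ are used. Each model $f_i$ responds to each query $q_j$ exactly $r$ times; the $k$-th response is $f_i(q_j)_k$. An embedding function $g:\mathcal{X}\to\mathbb{R}^s$ maps responses to vectors, and for each $i,j$ the vectors $g(f_i(q_j)_k)$, $k=1,\dots,r$, are i.i.d. with distribution $F_{ij}$ on $\mathbb{R}^s$, which has a mean and a covariance matrix. $\bar{\mathbf{X}}_i\in\mathbb{R}^{m\times s}$ is the matrix whose $j$-th row is $\frac{1}{r}\sum_{k=1}^r g(f_i(q_j)_k)$, and $\boldsymbol{\mu}_i\in\mathbb{R}^{m\times s}$ is the matrix whose $j$-th row is the mean of $F_{ij}$. $\mathbf{D}\in\mathbb{R}^{n\times n}$ is the random matrix with entries $\mathbf{D}_{ii'}=\frac{1}{m}\lVert\bar{\mathbf{X}}_i-\bar{\mathbf{X}}_{i'}\rVert_F$. All of these depend on $r$ (and on $m=m(r)$). *)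

(* Defs.v *)
From HB Require Import structures.
From mathcomp Require Import all_boot all_order all_algebra finmap.
From mathcomp Require Import all_classical all_reals all_analysis.

Set Implicit Arguments.
Unset Strict Implicit.
Unset Printing Implicit Defensive.

Import Order.TTheory GRing.Theory Num.Theory.
Import numFieldNormedType.Exports.

Local Open Scope classical_set_scope.
Local Open Scope ring_scope.

(* `|A| on matrices is the maximum norm, hence the two norms below. *)
Definition eucl_norm (R : realType) (q : nat) (v : 'rV[R]_q) : R :=
  Num.sqrt (\sum_(l < q) v 0 l ^+ 2).

Definition frob_norm (R : realType) (a b : nat) (A : 'M[R]_(a, b)) : R :=
  Num.sqrt (\sum_(i < a) \sum_(j < b) A i j ^+ 2).

(* R^s with its Borel sigma-algebra (the one generated by the open sets). *)
Definition borel_rV (R : realType) (s : nat) : measurableType _ :=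
  g_sigma_algebraType (@open 'rV[R]_s).

Section distribution_on_Rs.
Context (R : realType) (s : nat).

Definition coord_rV (l : 'I_s) (x : borel_rV R s) : R := (x : 'rV[R]_s) 0 l.

Variable F : probability (borel_rV R s) R.

Definition mean_rV : 'rV[R]_s := \row_l fine 'E_F[coord_rV l].

Definition cov_mx : 'M[R]_s :=
  \matrix_(l, l') fine (covariance F (coord_rV l) (coord_rV l')).

(* [fine] sends infinite values to 0, so mean_rV and cov_mx are meaningful only
   under these integrability conditions. *)
Definition has_mean : Prop :=
  forall l, F.-integrable setT (EFin \o coord_rV l).

Definition has_cov_mx : Prop :=
  forall l l', F.-integrable setT (fun x =>
    ((coord_rV l x - mean_rV 0 l) * (coord_rV l' x - mean_rV 0 l'))%:E).

End distribution_on_Rs.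

Section probability_notions.
Context (d : measure_display) (Omega : measurableType d) (R : realType).
Variable P : probability Omega R.

Definition mutually_independent (d' : measure_display) (V : measurableType d')
    (X : nat -> Omega -> V) : Prop :=
  forall (K : {fset nat}) (A : nat -> set V),
    (forall k, k \in K -> measurable (A k)) ->
    P (\bigcap_(k in [set` K]) (X k @^-1` A k)) =
    (\prod_(k <- K) P (X k @^-1` A k))%E.

Definition has_law (d' : measure_display) (V : measurableType d')
    (X : Omega -> V) (F : probability V R) : Prop :=
  measurable_fun setT X /\
  forall A : set V, measurable A -> P (X @^-1` A) = F A.

Definition iid_with_law (d' : measure_display) (V : measurableType d')
    (X : nat -> Omega -> V) (F : probability V R) : Prop :=
  mutually_independent X /\ forall k, has_law (X k) F.

Definition cvg_in_probability (Y : nat -> Omega -> R) (Z : Omega -> R) : Prop :=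
  forall eps : R, 0 < eps ->
    P [set w | eps < `|Y r w - Z w|] @[r --> \oo] --> (0 : \bar R).

End probability_notions.

(* Models, queries and replicates are indexed from 0: the first m queries are
   q 0, ..., q (m - 1), the first r replicates are k = 0, ..., r - 1, and
   f i x k w is the k-th response of model i to query x at the outcome w. *)
Section generative_models.
Context (R : realType) (Omega Q X : Type) (n s : nat).
Variables (f : 'I_n -> Q -> nat -> Omega -> X) (q : nat -> Q).
Variable g : X -> 'rV[R]_s.

Definition embedded_response (i : 'I_n) (j k : nat) (w : Omega) :
  borel_rV R s := g (f i (q j) k w).

Definition Xbar (m r : nat) (i : 'I_n) (w : Omega) : 'M[R]_(m, s) :=
  \matrix_(j < m) (r%:R^-1 *: \sum_(k < r) g (f i (q j) k w)).

Definition D_mx (m r : nat) (w : Omega) : 'M[R]_n :=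
  \matrix_(i, i') (m%:R^-1 * frob_norm (Xbar m r i w - Xbar m r i' w)).

Variable F : 'I_n -> nat -> probability (borel_rV R s) R.

Definition mu_mx (m : nat) (i : 'I_n) : 'M[R]_(m, s) :=
  \matrix_(j < m) mean_rV (F i j).

Definition Delta_mx (m : nat) : 'M[R]_n :=
  \matrix_(i, i') (m%:R^-1 * frob_norm (mu_mx m i - mu_mx m i')).

Definition gamma (i : 'I_n) (j : nat) : R := \tr (cov_mx (F i j)).

End generative_models.

Definition Delta_infty (R : realType) (n p : nat) (phi : 'I_n -> 'rV[R]_p) :
  'M[R]_n := \matrix_(i, i') eucl_norm (phi i - phi i').

(* Main.v *)
(* Since the replicates are i.i.d., the cross terms of the squared error of an
   empirical mean vanish in expectation, so that
   E ||Xbar_i - mu_i||_F^2 = r^-1 * \sum_j gamma_ij.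
   After division by m^2 this tends to 0 by the variance hypothesis, and Markov's
   inequality makes every m^-1 * ||Xbar_i - mu_i||_F small with high probability.
   By the triangle inequality D_ii' differs from Delta_ii' by at most the sum of
   two such errors, and Delta_ii' converges by assumption. *)

Require Import Defs.
From HB Require Import structures.
From mathcomp Require Import all_boot all_order all_algebra finmap.
From mathcomp Require Import all_classical all_reals all_analysis.
From mathcomp Require Import ring measurable_realfun.

Set Implicit Arguments.
Unset Strict Implicit.
Unset Printing Implicit Defensive.

Import Order.TTheory GRing.Theory Num.Theory.
Import numFieldNormedType.Exports.

Local Open Scope classical_set_scope.
Local Open Scope ring_scope.

(** * Cauchy-Schwarz and norm inequalities for the Frobenius norm *)

Section frobenius_norm.
Variable R : realType.

Lemma sum_mul_sqr_le (I : finType) (a b : I -> R) :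
  (\sum_i a i * b i) ^+ 2 <= (\sum_i a i ^+ 2) * (\sum_i b i ^+ 2).
Proof.
(* Lagrange's identity. *)
have : 0 <= \sum_i \sum_j (a i * b j - a j * b i) ^+ 2.
  by apply: sumr_ge0 => i _; apply: sumr_ge0 => j _; exact: sqr_ge0.
have -> : \sum_i \sum_j (a i * b j - a j * b i) ^+ 2 =
    ((\sum_i a i ^+ 2) * (\sum_i b i ^+ 2) - (\sum_i a i * b i) ^+ 2) *+ 2.
  have AB : (\sum_i a i ^+ 2) * (\sum_i b i ^+ 2) =
      \sum_i \sum_j a i ^+ 2 * b j ^+ 2 by rewrite big_distrlr.
  have BA : (\sum_i a i ^+ 2) * (\sum_i b i ^+ 2) =
      \sum_i \sum_j a j ^+ 2 * b i ^+ 2 by rewrite AB exchange_big.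
  rewrite mulrnBl mulr2n {1}AB BA expr2 big_distrlr/= -sumrMnl.
  rewrite -big_split -sumrB; apply: eq_bigr => i _ /=.
  rewrite -sumrMnl -big_split -sumrB; apply: eq_bigr => j _ /=.
  by ring.
by rewrite -mulr_natl pmulr_rge0 ?ltr0n// subr_ge0.
Qed.

Lemma frob_norm_ge0 (a b : nat) (A : 'M[R]_(a, b)) : 0 <= frob_norm A.
Proof. exact: sqrtr_ge0. Qed.

Lemma frob_normN (a b : nat) (A : 'M[R]_(a, b)) : frob_norm (- A) = frob_norm A.
Proof.
congr Num.sqrt; apply: eq_bigr => i _; apply: eq_bigr => j _.
by rewrite mxE sqrrN.
Qed.

Lemma frob_norm_sqr (a b : nat) (A : 'M[R]_(a, b)) :
  frob_norm A ^+ 2 = \sum_i \sum_j A i j ^+ 2.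
Proof.
rewrite sqr_sqrtr//; apply: sumr_ge0 => i _; apply: sumr_ge0 => j _.
exact: sqr_ge0.
Qed.

(** After squaring both sides, only the cross term has to be compared; flattening the double sums to
    one sum over index pairs turns this into Cauchy-Schwarz. *)
Lemma ler_frob_normD (a b : nat) (A B : 'M[R]_(a, b)) :
  frob_norm (A + B) <= frob_norm A + frob_norm B.
Proof.
rewrite -ler_sqr ?nnegrE ?addr_ge0 ?frob_norm_ge0// sqrrD !frob_norm_sqr.
have cs : \sum_i \sum_j A i j * B i j <= frob_norm A * frob_norm B.
  rewrite (le_trans (ler_norm _))// -ler_sqr ?nnegrE ?mulr_ge0 ?frob_norm_ge0//.
  rewrite real_normK ?num_real// exprMn !frob_norm_sqr !pair_bigA /=.
  exact: sum_mul_sqr_le.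
have -> : \sum_i \sum_j (A + B) i j ^+ 2 =
    \sum_i \sum_j A i j ^+ 2 + (\sum_i \sum_j A i j * B i j) *+ 2 +
    \sum_i \sum_j B i j ^+ 2.
  rewrite -sumrMnl -!big_split; apply: eq_bigr => i _ /=.
  by rewrite -sumrMnl -!big_split; apply: eq_bigr => j _ /=; rewrite mxE sqrrD.
by rewrite lerD2r lerD2l lerMn2r cs.
Qed.

Lemma ler_dist_frob_norm (a b : nat) (A B : 'M[R]_(a, b)) :
  `|frob_norm A - frob_norm B| <= frob_norm (A - B).
Proof.
have h (C D : 'M[R]_(a, b)) : frob_norm C - frob_norm D <= frob_norm (C - D).
  by rewrite lerBlDr -{1}(subrK D C) ler_frob_normD.
by rewrite ler_norml h andbT lerNl opprB -(frob_normN (A - B)) opprB h.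
Qed.

(** Reduces convergence of matrices of fixed size to entrywise bounds: [n ^ 2] squares, each at most
    [c ^+ 2], add up to the square of [n%:R * c]. *)
Lemma frob_norm_le_entry (n : nat) (A : 'M[R]_n) (c : R) :
  0 <= c -> (forall i j, `|A i j| <= c) -> frob_norm A <= n%:R * c.
Proof.
move=> c0 Ac; rewrite -ler_sqr ?nnegrE ?mulr_ge0 ?frob_norm_ge0 ?ler0n//.
rewrite frob_norm_sqr exprMn -natrX.
have : \sum_i \sum_j A i j ^+ 2 <= \sum_(i < n) \sum_(j < n) c ^+ 2.
  apply: ler_sum => i _; apply: ler_sum => j _.
  by rewrite -(real_normK (num_real (A i j))) ler_sqr ?nnegrE.
by rewrite !sumr_const !card_ord -mulrnA -(mulr_natl (c ^+ 2)) mulnn.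
Qed.

End frobenius_norm.

(** * Integration against the law of a random variable *)

Section change_of_variables.
Context (d d' : measure_display) (T : measurableType d) (U : measurableType d')
  (R : realType).
Variables (mu : {measure set T -> \bar R}) (nu : {measure set U -> \bar R}).
Variable Y : T -> U.
Hypothesis mY : measurable_fun setT Y.
Hypothesis muY : forall A, measurable A -> mu (Y @^-1` A) = nu A.

Lemma ge0_integral_law (h : U -> \bar R) :
  measurable_fun setT h -> (forall x, 0 <= h x)%E ->
  (\int[mu]_w h (Y w) = \int[nu]_x h x)%E.
Proof.
move=> mh h0.
have := ge0_integral_pushforward mY mu measurableT mh (fun y _ => h0 y).
rewrite preimage_setT /= => <-.
by apply: eq_measure_integral => A mA _; exact: muY.
Qed.

Lemma integrable_law (h : U -> \bar R) :
  nu.-integrable setT h -> mu.-integrable setT (fun w => h (Y w)).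
Proof.
move=> /integrableP[mh ih]; apply/integrableP; split.
  exact: (measurableT_comp mh mY).
rewrite (ge0_integral_law (h := fun x => `|h x|%E))//.
exact: measurableT_comp.
Qed.

Lemma integral_law (h : U -> \bar R) : nu.-integrable setT h ->
  (\int[mu]_w h (Y w) = \int[nu]_x h x)%E.
Proof.
move=> ih; have mh := measurable_int _ ih.
have := integral_pushforward mY (D := setT) mh (integrable_law ih) measurableT.
rewrite preimage_setT /= => <-.
by apply: eq_measure_integral => A mA _; exact: muY.
Qed.

End change_of_variables.

(** * Fubini for the product of two copies of an integrable function *)

Section product_of_integrable.
Context (d : measure_display) (V : measurableType d) (R : realType).
Variables (F : probability V R) (h : V -> R).
Hypothesis ih : F.-integrable setT (EFin \o h).

(** By Tonelli, the integral of the absolute value factors into the square of the integral of [|h|],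
    which is finite. *)
Lemma integrable_prod_mul :
  (F \x F)%E.-integrable setT (fun z => (h z.1 * h z.2)%:E).
Proof.
have mh : measurable_fun setT h.
  by apply/measurable_EFinP; exact: measurable_int ih.
apply/integrable12ltyP.
  apply/measurable_EFinP; apply: measurable_funM.
    exact: (measurableT_comp mh measurable_fst).
  exact: (measurableT_comp mh measurable_snd).
under eq_integral => x _.
  under eq_integral => y _ do rewrite EFinM abseM /=.
  rewrite ge0_integralZl//=; last by do 2 apply: measurableT_comp => //.
  over.
rewrite ge0_integralZr//=.
- have /integrableP[_ ih_lty] := ih.
  rewrite lte_mul_pinfty ?integral_ge0// ge0_fin_numE ?integral_ge0//.
- by do 2 apply: measurableT_comp => //.
- exact: integral_ge0.
Qed.

Lemma integral_prod_mul : (\int[(F \x F)]_z (h z.1 * h z.2)%:E =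
  (\int[F]_x (h x)%:E) * (\int[F]_x (h x)%:E))%E.
Proof.
rewrite -integral12_prod_meas1; last exact: integrable_prod_mul.
under eq_integral => x _.
  rewrite /fubini_F /=.
  under eq_integral => y _ do rewrite EFinM /=.
  rewrite integralZl//; over.
have /fineK c_fin : (\int[F]_x (h x)%:E)%E \is a fin_num.
  exact: integrable_fin_num.
by rewrite -{1}c_fin integralZr// c_fin.
Qed.

End product_of_integrable.

(** * Second moment of the empirical mean of centred i.i.d. variables *)

Section iid.
Context (d d' : measure_display) (Omega : measurableType d)
  (V : measurableType d') (R : realType).
Variables (P : probability Omega R) (F : probability V R).
Variable X : nat -> Omega -> V.
Hypothesis X_iid : iid_with_law P X F.

Let mX k : measurable_fun setT (X k). Proof. exact: (X_iid.2 k).1. Qed.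

(** A measure on the product space that agrees with [F \x F] on measurable rectangles equals it; on
    a rectangle, the agreement is independence for the index set [{k, k'}]. *)
Lemma iid_joint_law (k k' : nat) (A : set (V * V)) : k != k' ->
  measurable A -> P ((fun w => (X k w, X k' w)) @^-1` A) = (F \x F)%E A.
Proof.
move=> kk' mA; have mXX := measurable_fun_pair (mX k) (mX k').
pose PXX := pushforward P (fun w => (X k w, X k' w)).
rewrite (product_measure_unique (m' := PXX))//.
move=> B C mB mC /=.
pose K : {fset nat} := [fset k; k']%fset.
(* Independence takes a family of sets indexed by all of [nat]; only its values at [k] and [k']
   matter, and [k != k'] makes the second one [C]. *)
pose E i : set V := if i == k then B else C.
have Ek : E k = B by rewrite /E eqxx.
have Ek' : E k' = C by rewrite /E eq_sym (negbTE kk').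
rewrite (_ : pushforward _ _ _ = P (\bigcap_(i in [set` K]) (X i @^-1` E i))).
  rewrite X_iid.1; last by move=> i _; rewrite /E; case: ifP.
  rewrite big_fsetU1 ?inE//= big_seq_fset1 Ek Ek'.
  by rewrite !(X_iid.2 _).2.
congr (P _); apply/seteqP; split => w /=.
  by rewrite -Ek -Ek' => -[Bw Cw] i /=; rewrite !inE => /orP[]/eqP ->.
move=> XE; split.
  by rewrite -Ek; apply: XE; rewrite /= !inE eqxx.
by rewrite -Ek'; apply: XE; rewrite /= !inE eqxx orbT.
Qed.

Variable h : V -> R.
Hypothesis ih : F.-integrable setT (EFin \o h).
Hypothesis h_centered : (\int[F]_x (h x)%:E = 0)%E.
Hypothesis ih2 : F.-integrable setT (fun x => (h x ^+ 2)%:E).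

(** On the diagonal this is the law of a single variable; off it, the joint law is a product, so the
    moment factors into two vanishing means. *)
Let iid_mul_moment (k k' : nat) :
  P.-integrable setT (fun w => (h (X k w) * h (X k' w))%:E) /\
  (\int[P]_w (h (X k w) * h (X k' w))%:E =
   if k == k' then \int[F]_x (h x ^+ 2)%:E else 0)%E.
Proof.
case: eqVneq => [<-|kk'].
  split; last exact: (integral_law (mX k) (X_iid.2 k).2 ih2).
  exact: (integrable_law (mX k) (X_iid.2 k).2 ih2).
have mXX := measurable_fun_pair (mX k) (mX k').
have lawXX A := @iid_joint_law k k' A kk'.
split; first exact: (integrable_law mXX lawXX (integrable_prod_mul ih)).
rewrite (integral_law mXX lawXX (integrable_prod_mul ih)).
by rewrite integral_prod_mul// h_centered mule0.
Qed.

(** Of the [r ^ 2] products in the expanded square only the [r] diagonal ones survive integration,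
    and [r / r ^ 2] is [r^-1]. *)
Lemma iid_mean_second_moment (r : nat) : (0 < r)%N ->
  (\int[P]_w ((r%:R^-1 * \sum_(k < r) h (X k w)) ^+ 2)%:E =
   r%:R^-1%:E * \int[F]_x (h x ^+ 2)%:E)%E.
Proof.
move=> r0.
(* The cross products have no constant sign, so exchanging sum and integral rests on
   integrability. *)
have iS k : P.-integrable setT
    (fun w => \sum_(k' < r) (h (X k w) * h (X k' w))%:E)%E.
  by apply: integrable_sum => // k' _; exact: (iid_mul_moment k k').1.
have iSS : P.-integrable setT
    (fun w => \sum_(k < r) \sum_(k' < r) (h (X k w) * h (X k' w))%:E)%E.
  by apply: integrable_sum => // k _; exact: iS.
under eq_integral => w _.
  rewrite exprMn EFinM (expr2 (\sum_(k < r) _)) big_distrlr/= -sumEFin.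
  under eq_bigr => k _ do rewrite -sumEFin.
  over.
rewrite integralZl//= integral_sum//.
under eq_bigr => k _.
  rewrite integral_sum//; last by move=> k'; exact: (iid_mul_moment k k').1.
  under eq_bigr => k' _ do rewrite (iid_mul_moment k k').2.
  rewrite (bigD1 k)//= eqxx big1 ?adde0; last first.
    by move=> k' k'k; rewrite eq_sym val_eqE (negbTE k'k).
  over.
have /fineK <- : (\int[F]_x (h x ^+ 2)%:E)%E \is a fin_num.
  exact: integrable_fin_num.
rewrite sumEFin -!EFinM sumr_const card_ord -(mulr_natl (fine _)) mulrA.
congr (_ * _)%:E.
by rewrite expr2 -mulrA mulVf ?mulr1// pnatr_eq0 -lt0n.
Qed.

End iid.

(** * Measurability of coordinates and of the Frobenius norm *)

Section measurability.
Variable R : realType.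

(** Coordinates are continuous, so they pull open intervals, which generate the Borel sets of the
    line, back to open sets. *)
Lemma measurable_coord_rV (s : nat) (l : 'I_s) :
  measurable_fun setT (@coord_rV R s l).
Proof.
apply: (measurability _ (RGenOpens.measurableE R)) => _ [_ [a [b ->] <-]].
rewrite setTI; apply: sub_sigma_algebra.
have /continuousP := @coord_continuous R 1 s 0 l; apply; exact: interval_open.
Qed.

Lemma measurable_frob_norm (d : measure_display) (T : measurableType d)
    (a b : nat) (A : T -> 'M[R]_(a, b)) :
  (forall i j, measurable_fun setT (fun w => A w i j)) ->
  measurable_fun setT (fun w => frob_norm (A w)).
Proof.
move=> mA; apply: (measurableT_comp (f := @Num.sqrt R)).
  by apply: continuous_measurable_fun => x; exact: sqrt_continuous.
apply: measurable_sum => i; apply: measurable_sum => j.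
exact: measurable_funX.
Qed.

End measurability.

(** * Centred coordinates and the diagonal of the covariance matrix *)

Section covariance_trace.
Context (R : realType) (s : nat) (F : probability (borel_rV R s) R).

(** Provides the centring hypothesis for the second-moment computation; integrability makes the
    expectation finite, so that [fine] in [mean_rV] loses nothing. *)
Lemma integral_centered_coord (l : 'I_s) : has_mean F ->
  F.-integrable setT (EFin \o (fun x => coord_rV l x - mean_rV F 0 l)) /\
  (\int[F]_x (coord_rV l x - mean_rV F 0 l)%:E = 0)%E.
Proof.
move=> /(_ l) il.
have ic : F.-integrable setT (EFin \o cst (mean_rV F 0 l)).
  exact: finite_measure_integrable_cst.
split; first exact: (integrableB measurableT il ic).
under eq_integral do rewrite EFinB.
rewrite integralB//= integral_cst// [X in (_ - _ * X)%E]probability_setT mule1.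
rewrite mxE unlock.
by rewrite fineK ?subee//; exact: integrable_fin_num.
Qed.

Lemma integral_centered_coord_sqr (l : 'I_s) : has_cov_mx F ->
  F.-integrable setT (fun x => ((coord_rV l x - mean_rV F 0 l) ^+ 2)%:E) /\
  (\int[F]_x ((coord_rV l x - mean_rV F 0 l) ^+ 2)%:E = (cov_mx F l l)%:E)%E.
Proof.
move=> /(_ l l) il; split; first exact: il.
have E : covariance F (coord_rV l) (coord_rV l) =
    (\int[F]_x ((coord_rV l x - mean_rV F 0 l) ^+ 2)%:E)%E.
  rewrite !unlock; apply: eq_integral => x _.
  by rewrite mxE unlock.
by rewrite [cov_mx _ _ _]mxE E fineK//; exact: integrable_fin_num.
Qed.

End covariance_trace.

(** * Error of the empirical means, and its effect on the distance matrix *)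

Section models.
Context (R : realType) (d : measure_display) (Omega : measurableType d)
  (P : probability Omega R) (Q X : Type) (n s : nat)
  (f : 'I_n -> Q -> nat -> Omega -> X) (q : nat -> Q) (g : X -> 'rV[R]_s)
  (F : 'I_n -> nat -> probability (borel_rV R s) R).
Hypothesis responses_iid : forall i j,
  iid_with_law P (embedded_response f q g i j) (F i j).

(** The output space [X] is a bare type, so measurability is drawn from the embedded responses,
    which take values in [borel_rV R s]. *)
Lemma measurable_Xbar (m r : nat) (i : 'I_n) (j : 'I_m) (l : 'I_s) :
  measurable_fun setT (fun w => Xbar f q g m r i w j l).
Proof.
rewrite (_ : (fun w => _) = (fun w => r%:R^-1 *
    \sum_(k < r) coord_rV l (embedded_response f q g i j k w))).
  apply: measurable_funM => //; apply: measurable_sum => k.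
  exact: (measurableT_comp (measurable_coord_rV l) ((responses_iid i j).2 k).1).
by apply/funext => w; rewrite !mxE summxE.
Qed.

(** Each entry of the error is an empirical mean of centred i.i.d. reals, with second moment [r^-1]
    times a coordinate variance; along row [j] these variances add up to the trace [gamma F i j]. *)
Lemma Xbar_mean_squared_error (m r : nat) (i : 'I_n) :
  (forall j, has_mean (F i j)) -> (forall j, has_cov_mx (F i j)) -> (0 < r)%N ->
  (\int[P]_w (frob_norm (Xbar f q g m r i w - mu_mx F m i) ^+ 2)%:E =
   (r%:R^-1 * \sum_(j < m) gamma F i j)%:E)%E.
Proof.
move=> F_mean F_cov r0.
pose h (j : 'I_m) (l : 'I_s) (x : borel_rV R s) :=
  coord_rV l x - mean_rV (F i j) 0 l.
pose Y (j : 'I_m) (l : 'I_s) (w : Omega) : R :=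
  r%:R^-1 * \sum_(k < r) h j l (embedded_response f q g i j k w).
(* The mean moves inside the average because averaging [r] copies of it returns it, which requires
   [r] to be nonzero. *)
have XY w j l : (Xbar f q g m r i w - mu_mx F m i) j l = Y j l w.
  rewrite /Y /h sumrB sumr_const card_ord mulrBr !mxE summxE.
  by rewrite -[in RHS](mulr_natl (fine _)) mulKf// pnatr_eq0 -lt0n.
have mY j l : measurable_fun setT (Y j l).
  rewrite (_ : Y j l = fun w => Xbar f q g m r i w j l - mean_rV (F i j) 0 l).
    by apply: measurable_funB => //; exact: measurable_Xbar.
  by apply/funext => w; rewrite -XY !mxE.
have mYY j l : measurable_fun setT (fun w => (Y j l w ^+ 2)%:E).
  by apply/measurable_EFinP; exact: measurable_funX.
under eq_integral => w _.
  rewrite frob_norm_sqr -sumEFin.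
  under eq_bigr => j _.
    rewrite -sumEFin.
    under eq_bigr => l _ do rewrite XY.
    over.
  over.
rewrite ge0_integral_sum//; last 2 first.
- by move=> j; apply: emeasurable_sum => l.
- by move=> j w _; apply: sume_ge0 => l _; rewrite lee_fin sqr_ge0.
rewrite mulr_sumr -sumEFin; apply: eq_bigr => j _.
rewrite ge0_integral_sum//; last by move=> l w _; rewrite lee_fin sqr_ge0.
rewrite /gamma /mxtrace mulr_sumr -sumEFin; apply: eq_bigr => l _.
have [ih h_centered] := integral_centered_coord l (F_mean j).
have [ih2 ihE] := integral_centered_coord_sqr l (F_cov j).
rewrite (iid_mean_second_moment (responses_iid i j) ih h_centered ih2 r0).
by rewrite ihE.
Qed.

(** The deterministic part, at a fixed outcome: an entry is off by at most [e] for each of its two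
    models and [e] for [Delta_mx], whence the 3; the factor [n] comes from passing from entries to
    the norm. *)
Lemma D_mx_dist_le (p : nat) (phi : 'I_n -> 'rV[R]_p) (m r : nat) (w : Omega)
    (e : R) : 0 <= e ->
  (forall i, m%:R^-1 * frob_norm (Xbar f q g m r i w - mu_mx F m i) <= e) ->
  (forall i i', `|Delta_mx F m i i' - eucl_norm (phi i - phi i')| <= e) ->
  frob_norm (D_mx f q g m r w - Delta_infty phi) <= n%:R * (e *+ 3).
Proof.
move=> e0 err_le Delta_le; apply: frob_norm_le_entry => [|i i'].
  by rewrite mulrn_wge0.
have m0 : 0 <= m%:R^-1 :> R by rewrite invr_ge0.
set D := D_mx f q g m r w i i'; set phi_dist := eucl_norm (phi i - phi i').
have -> : (D_mx f q g m r w - Delta_infty phi) i i' = D - phi_dist.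
  by rewrite mxE [X in _ + X]mxE [Delta_infty _ _ _]mxE.
have D_le : `|D - Delta_mx F m i i'| <= e *+ 2.
  rewrite /D !mxE -mulrBr normrM ger0_norm//.
  apply: (le_trans (ler_wpM2l m0 (ler_dist_frob_norm _ _))).
  set Xi := Xbar f q g m r i w; set Xi' := Xbar f q g m r i' w.
  have -> : Xi - Xi' - (mu_mx F m i - mu_mx F m i') =
      (Xi - mu_mx F m i) + - (Xi' - mu_mx F m i').
    by rewrite !opprB addrACA [in RHS]addrACA; congr (_ + _); rewrite addrC.
  apply: (le_trans (ler_wpM2l m0 (ler_frob_normD _ _))).
  by rewrite frob_normN mulrDr mulr2n; exact: lerD (err_le i) (err_le i').
have -> : D - phi_dist =
    (D - Delta_mx F m i i') + (Delta_mx F m i i' - phi_dist).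
  by rewrite addrA subrK.
by rewrite (le_trans (ler_normD _ _))// mulrSr; exact: lerD.
Qed.

Lemma measurable_Xbar_error (m r : nat) (i : 'I_n) :
  measurable_fun setT (fun w => frob_norm (Xbar f q g m r i w - mu_mx F m i)).
Proof.
apply: measurable_frob_norm => j l.
rewrite (_ : (fun w => _) = fun w => Xbar f q g m r i w j l - mu_mx F m i j l).
  by apply: measurable_funB => //; exact: measurable_Xbar.
by apply/funext => w; rewrite [LHS]mxE [X in _ + X]mxE.
Qed.

Lemma measurable_D_error (p : nat) (phi : 'I_n -> 'rV[R]_p) (m r : nat) :
  measurable_fun setT
    (fun w => frob_norm (D_mx f q g m r w - Delta_infty phi)).
Proof.
apply: measurable_frob_norm => i i'.
rewrite (_ : (fun w => _) = fun w => m%:R^-1 *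
    frob_norm (Xbar f q g m r i w - Xbar f q g m r i' w) -
    eucl_norm (phi i - phi i')).
  apply: measurable_funB => //; apply: measurable_funM => //.
  apply: measurable_frob_norm => j l.
  rewrite (_ : (fun w => _) =
      fun w => Xbar f q g m r i w j l - Xbar f q g m r i' w j l).
    by apply: measurable_funB; exact: measurable_Xbar.
  by apply/funext => w; rewrite [LHS]mxE [X in _ + X]mxE.
by apply/funext => w; rewrite [LHS]mxE [X in _ + X]mxE [D_mx _ _ _ _ _ _ _ _]mxE
  [Delta_infty _ _ _]mxE.
Qed.

(** Summing the squared errors over the models lets one event control all of them at once. The
    factor [m^-2] is split so that the bound shows the quantity of the variance hypothesis, times a
    further [m^-1]. *)
Lemma Xbar_markov (m r : nat) (t : R) :
  (forall i j, has_mean (F i j)) -> (forall i j, has_cov_mx (F i j)) ->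
  (0 < r)%N -> 0 < t ->
  (P [set w | (t <= \sum_i (m%:R^-1 *
      frob_norm (Xbar f q g m r i w - mu_mx F m i)) ^+ 2)%R]
   <= (t^-1 * \sum_i m%:R^-1 *
      ((m%:R^-1 * \sum_(j < m) gamma F i j) / r%:R))%:E)%E.
Proof.
move=> F_mean F_cov r0 t0.
pose err i w := frob_norm (Xbar f q g m r i w - mu_mx F m i).
pose S w := \sum_i (m%:R^-1 * err i w) ^+ 2.
have S0 w : 0 <= S w by apply: sumr_ge0 => i _; exact: sqr_ge0.
have merr i : measurable_fun setT (err i).
  exact: measurable_Xbar_error.
have mS : measurable_fun setT S.
  by apply: measurable_sum => i; apply: measurable_funX; exact: measurable_funM.
have iS : (\int[P]_w (S w)%:E = (\sum_i m%:R^-1 *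
      ((m%:R^-1 * \sum_(j < m) gamma F i j) / r%:R))%:E)%E.
  under eq_integral => w _.
    rewrite -sumEFin.
    under eq_bigr => i _ do rewrite exprMn EFinM.
    over.
  rewrite -sumEFin ge0_integral_sum//; last 2 first.
  - move=> i; apply: measurable_funeM; apply/measurable_EFinP.
    exact: measurable_funX.
  - by move=> i w _; rewrite -EFinM lee_fin mulr_ge0// sqr_ge0.
  apply: eq_bigr => i _; rewrite ge0_integralZl//; last 2 first.
  - by apply/measurable_EFinP; exact: measurable_funX.
  - by move=> w _; rewrite lee_fin sqr_ge0.
  rewrite Xbar_mean_squared_error// -EFinM; congr (_%:E).
  by rewrite expr2 -!mulrA (mulrC r%:R^-1).
(* Markov's inequality, with the identity as the nondecreasing function; the absolute values it
   introduces are removed by [S0]. *)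
have markov := le_integral_comp_abse P measurableT (g := EFin \o S)
  (f := fun x => x) (@measurable_id _ _ _) (fun r h => h)
  (fun _ _ _ _ h => h) (iffRL (measurable_EFinP _ _) mS) t0.
rewrite EFinM -iS lee_pdivlMl//.
have absS w : (`|(EFin \o S) w| = (S w)%:E)%E by rewrite /= ger0_norm.
under [X in (_ <= X)%E]eq_integral do rewrite -absS.
move: markov; rewrite setTI; congr (_ * P _ <= _)%E.
by apply/seteqP; split => w /=; rewrite ger0_norm.
Qed.

End models.

Theorem theorem2 (R : realType) (d : measure_display) (Omega : measurableType d)
  (P : probability Omega R) (Q X : Type) (n s : nat)
  (f : 'I_n -> Q -> nat -> Omega -> X) (q : nat -> Q) (g : X -> 'rV[R]_s)
  (F : 'I_n -> nat -> probability (borel_rV R s) R)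
  (F_mean : forall i j, has_mean (F i j))
  (F_cov : forall i j, has_cov_mx (F i j))
  (responses_iid : forall i j,
    iid_with_law P (embedded_response f q g i j) (F i j))
  (m : nat -> nat) (m_infty : m r @[r --> \oo] --> \oo)
  (p : nat) (phi : 'I_n -> 'rV[R]_p)
  (Delta_cvg : forall i i',
    Delta_mx F (m r) i i' @[r --> \oo] --> eucl_norm (phi i - phi i'))
  (gamma_cvg : forall i,
    ((m r)%:R^-1 * \sum_(j < m r) gamma F i j) / r%:R @[r --> \oo] --> (0 : R)) :
  cvg_in_probability P
    (fun r w => frob_norm (D_mx f q g (m r) r w - Delta_infty phi))
    (cst 0).
Proof.
move=> eps eps0.
(* Chosen to make [n%:R * (e *+ 3)] at most [eps]; [n.+1] in place of [n] keeps the divisor positive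
   when there are no models. *)
pose e := eps / (n.+1 * 3)%:R.
have e0 : 0 < e by rewrite divr_gt0// ltr0n.
have ne : n%:R * (e *+ 3) <= eps.
  rewrite -(mulr_natl e) mulrA -natrM /e mulrCA ger_pMr// ler_pdivrMr ?ltr0n//.
  by rewrite mul1r ler_nat leq_mul2r leqnSn.
pose v i r : R := (m r)%:R^-1 *
  (((m r)%:R^-1 * \sum_(j < m r) gamma F i j) / r%:R).
have v0 i : v i r @[r --> \oo] --> (0 : R).
  apply/norm_cvg0P; apply: (squeeze_cvgr _ (cvg_cst 0)); last first.
    by have := cvg_norm (gamma_cvg i); rewrite normr0; apply.
  (* The extra factor [(m r)%:R^-1] is at most 1, also when [m r] is 0, since the inverse of 0 is
     0. *)
  near=> r; rewrite normr_ge0 normrM ler_piMl// ger0_norm ?invr_ge0//.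
  by have [->|m0] := posnP (m r); rewrite ?invr0// invf_le1 ?ltr0n// ler1n.
have Sv0 : \sum_i v i r @[r --> \oo] --> \sum_(i < n) (0 : R).
  by apply: cvg_big => [|i _]; [exact: add_continuous|exact: v0].
rewrite big1// in Sv0.
have bound0 : ((e ^+ 2)^-1 * \sum_i v i r)%:E @[r --> \oo] --> (0 : \bar R).
  apply: cvg_EFin; first by near=> r.
  by have := cvgM (cvg_cst (e ^+ 2)^-1) Sv0; rewrite mulr0; apply.
(* There are finitely many pairs, so one threshold on [r] serves all of them. *)
have Delta_near : \forall r \near \oo, forall i i',
    `|Delta_mx F (m r) i i' - eucl_norm (phi i - phi i')| <= e.
  apply: filter_forall => i; apply: filter_forall => i'.
  have /cvgrPdist_le/(_ e e0) := Delta_cvg i i'.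
  by apply: filterS => r; rewrite distrC.
apply: (squeeze_cvge (f := cst (0 : \bar R)) _ (cvg_cst _) bound0); near=> r.
rewrite measure_ge0/=.
have r0 : (0 < r)%N by near: r; exact: nbhs_infty_gt.
(* Markov's inequality is used at level [e ^+ 2]; it remains to include the deviation event in the
   event that the summed squared errors reach this level. *)
apply: le_trans (Xbar_markov responses_iid (m r) F_mean F_cov r0 _); last first.
  by rewrite exprn_gt0.
apply: le_measure; rewrite ?inE.
- have mD := measurable_D_error responses_iid phi (m r) r.
  have := mD measurableT _ (measurable_itv `]eps, +oo[).
  rewrite setTI; congr measurable; apply/seteqP; split => w /=;
    by rewrite in_itv/= andbT subr0 ger0_norm ?frob_norm_ge0.
- pose err i w := (m r)%:R^-1 *
    frob_norm (Xbar f q g (m r) r i w - mu_mx F (m r) i).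
  have mS : measurable_fun setT (fun w => \sum_i err i w ^+ 2).
    apply: measurable_sum => i; apply: measurable_funX.
    by apply: measurable_funM => //; exact: measurable_Xbar_error.
  have := mS measurableT _ (measurable_itv `[e ^+ 2, +oo[).
  by rewrite setTI; congr measurable; apply/seteqP; split => w /=;
    rewrite in_itv/= andbT.
(* By contraposition: if the sum of squares is below [e ^+ 2], so is each summand, every model's
   error is at most [e], and the deterministic bound applies. *)
move=> w /=; rewrite subr0 ger0_norm ?frob_norm_ge0//; apply: contraTT.
rewrite -!ltNge -leNgt => S_lt.
apply: le_trans ne; apply: (D_mx_dist_le (F := F)) => [|i|i i'].
- exact: ltW.
- rewrite -ler_sqr ?nnegrE ?(ltW e0)// ?mulr_ge0 ?invr_ge0 ?frob_norm_ge0//.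
  apply: (le_trans _ (ltW S_lt)); rewrite (bigD1 i)//= lerDl.
  by apply: sumr_ge0 => *; exact: sqr_ge0.
- by move: i i'; near: r.
Unshelve. all: by end_near. Qed.
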